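(* Let $n\ge1$. The map $(\mathrm{vlk}_{ij}+\mathrm{vlk}_{ji})_{1\le i<j\le n}$ with values in $\mathbb{Z}^{\frac{n(n-1)}{2}}$ w-classifies $\mathrm{VC}$; that is, it is invariant under welded Reidemeister moves and under $\mathrm{VC}$, and the induced map $\mathrm{wSL}_n^{\mathrm{VC}}\to\mathbb{Z}^{\frac{n(n-1)}{2}}$ is an isomorphism of monoids.
   Context: A Gauss diagram on $n$ strands is a finite set of signed arrows (tail, head, sign $\pm1$), all endpoints being distinct points of $n$ ordered oriented intervals (strands), up to orientation-preserving homeomorphisms of the intervals; Gauss diagrams form a monoid under stacking (concatenation of corresponding strands). Endpoints are adjacent if they lie on the same strand with no other endpoint between them. Moves are used in both directions; portions of strands below are disjoint, contain only the mentioned endpoints, and may lie on any strands with any orientation. Welded Reidemeister moves: (R1) insert or delete an arrow of any sign with adjacent endpoints; (R2) insert or delete two arrows with opposite signs whose tails are adjacent on one portion and whose heads are adjacent on another; (R3) given portions $s_1,s_2,s_3$ containing exactly the endpoints of arrows $s_1\to s_2$, $s_2\to s_3$, $s_1\to s_3$ with signs $\varepsilon_{12},\varepsilon_{23},\varepsilon_{13}$, exchange the two endpoints on each portion, provided $\varepsilon_{12}\eta_1\eta_2=\varepsilon_{23}\eta_2\eta_3=-\varepsilon_{13}\eta_1\eta_3$, where $\eta_k=+1$ if along the orientation the endpoint on $s_k$ of the arrow joining $s_k$ and $s_{k-1}$ precedes that of the arrow joining $s_k$ and $s_{k+1}$ (indices mod 3), and $-1$ otherwise; (OC) exchange two adjacent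 tails. The monoid $\mathrm{wSL}_n$ of welded string links is the quotient of Gauss diagrams on $n$ strands by these moves (equivalently, virtual string link diagrams up to welded Reidemeister moves), and $\mathrm{wSL}_n^\mu$ is its quotient by a move $\mu$. $\mathrm{VC}$ (virtual conjugation): reverse the direction of an arrow, keeping its sign. For $i\neq j$, $\mathrm{vlk}_{ij}$ is the sum of the signs of all arrows with tail on strand $i$ and head on strand $j$. *)

(* Defs.v *)
From HB Require Import structures.
From Stdlib Require Import Relations.
From mathcomp Require Import all_boot all_order all_algebra.
From mathcomp Require Import boolp.
From mathcomp Require Import zify.

Set Implicit Arguments.
Unset Strict Implicit.
Unset Printing Implicit Defensive.

Import GRing.Theory Num.Theory.

Local Open Scope quotient_scope.

(* An endpoint carries the name of its arrow, its nature, and the sign of its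
   arrow ([true] for +1, [false] for -1). *)
Record endpoint := Endpoint {arrow : nat; is_head : bool; positive : bool}.

Definition endpoint_enc (e : endpoint) := (arrow e, is_head e, positive e).
Definition endpoint_dec (x : nat * bool * bool) :=
  Endpoint x.1.1 x.1.2 x.2.
Fact endpoint_encK : cancel endpoint_enc endpoint_dec. Proof. by case. Qed.
HB.instance Definition _ := Countable.copy endpoint (can_type endpoint_encK).

Definition tail (a : nat) (s : bool) := Endpoint a false s.
Definition head (a : nat) (s : bool) := Endpoint a true s.
Definition flip (e : endpoint) :=
  Endpoint (arrow e) (~~ is_head e) (positive e).
Definition relabel (f : nat -> nat) (e : endpoint) :=
  Endpoint (f (arrow e)) (is_head e) (positive e).
Definition sgn (s : bool) : int := if s then 1%R else (-1)%R.

Definition word := seq endpoint.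

(* Each strand is the word of its endpoints, read along the orientation. *)
Notation code n := {ffun 'I_n -> word}.

Definition endpoints n (c : code n) : word :=
  flatten [seq c i | i <- enum 'I_n].

(* Every arrow has exactly one tail and exactly one head, with a common sign. *)
Definition gauss_code n (c : code n) : bool :=
  uniq [seq (arrow e, is_head e) | e <- endpoints c]
  && all (fun e => flip e \in endpoints c) (endpoints c).

(* A Gauss diagram with named arrows; the names are forgotten by [same_diagram]
   below, which is part of the relation defining the monoids of string links. *)
Record gauss (n : nat) :=
  Gauss {gauss_val :> code n; gauss_valP : gauss_code gauss_val}.
HB.instance Definition _ n := [isSub for @gauss_val n].
HB.instance Definition _ n := [Choice of gauss n by <:].

Definition same_diagram n (D D' : gauss n) : Prop :=
  exists2 f : nat -> nat, injective f &
    forall i, D' i = [seq relabel f e | e <- D i].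

(* A diagram with holes: [inr h] stands for the h-th portion of a local move. *)
Definition template (n : nat) := 'I_n -> seq (endpoint + nat).

Definition holes n (c : template n) : seq nat :=
  flatten [seq pmap (fun x => if x is inr h then Some h else None) (c i)
          | i <- enum 'I_n].

Definition fill n (c : template n) (p : seq word) : code n :=
  [ffun i => flatten [seq match x with
                          | inl e => [:: e]
                          | inr h => nth [::] p h
                          end | x <- c i]].

(* A local move is given by the contents, before and after the move, of a list
   of portions of strands. Each portion occurs once in the template, on any
   strand and in any position relative to the other portions. *)
Definition rule := seq word -> seq word -> Prop.

Definition applies (r : rule) n (D D' : gauss n) : Prop :=
  exists (c : template n) (p q : seq word),
    [/\ r p q, perm_eq (holes c) (iota 0 (size p)),
        gauss_val D = fill c p & gauss_val D' = fill c q].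

Definition ord2 (o : bool) (x y : endpoint) : word :=
  if o then [:: x; y] else [:: y; x].

(* Each move is listed in one direction only: the reverse direction comes from
   the symmetric closure in [equivalent]. In [R3], the portions s_1, s_2, s_3
   are listed in this order, and eta_k is [sgn o_k]: on s_k, the first argument
   of [ord2] belongs to the arrow joining s_k and s_{k-1}, the second one to the
   arrow joining s_k and s_{k+1}, indices mod 3. *)
Inductive welded : rule :=
| R1 a s o :
    welded [:: [::]] [:: ord2 o (tail a s) (head a s)]
| R2 a b s o1 o2 :
    welded [:: [::]; [::]]
           [:: ord2 o1 (tail a s) (tail b (~~ s));
               ord2 o2 (head a s) (head b (~~ s))]
| R3 a12 a23 a13 s12 s23 s13 o1 o2 o3 :
    (sgn s12 * sgn o1 * sgn o2 = sgn s23 * sgn o2 * sgn o3)%R ->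
    (sgn s23 * sgn o2 * sgn o3 = - (sgn s13 * sgn o1 * sgn o3))%R ->
    welded [:: ord2 o1 (tail a13 s13) (tail a12 s12);
               ord2 o2 (head a12 s12) (tail a23 s23);
               ord2 o3 (head a23 s23) (head a13 s13)]
           [:: ord2 (~~ o1) (tail a13 s13) (tail a12 s12);
               ord2 (~~ o2) (head a12 s12) (tail a23 s23);
               ord2 (~~ o3) (head a23 s23) (head a13 s13)]
| OC a b s t :
    welded [:: [:: tail a s; tail b t]] [:: [:: tail b t; tail a s]].

Inductive VC_rule : rule :=
| VC_intro a s :
    VC_rule [:: [:: tail a s]; [:: head a s]]
            [:: [:: head a s]; [:: tail a s]].

Definition relabel_stable (r : rule) : Prop :=
  forall f p q, injective f -> r p q ->
    r [seq map (relabel f) w | w <- p] [seq map (relabel f) w | w <- q].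

Record move := Move {move_rule :> rule; moveP : relabel_stable move_rule}.

Lemma map_ord2 f o x y :
  map (relabel f) (ord2 o x y) = ord2 o (relabel f x) (relabel f y).
Proof. by case: o. Qed.

Lemma welded_stable : relabel_stable welded.
Proof.
move=> f p q _ [a s o|a b s o1 o2|a12 a23 a13 s12 s23 s13 o1 o2 o3 h1 h2|a b s t];
  rewrite /= ?map_ord2.
- exact: R1.
- exact: R2.
- exact: R3.
- exact: OC.
Qed.

Lemma VC_stable : relabel_stable VC_rule.
Proof. by move=> f p q _ []. Qed.

Definition VC : move := Move VC_stable.

Definition equivalent (mu : move) n : relation (gauss n) :=
  clos_refl_sym_trans _ (fun D D' =>
    [\/ same_diagram D D', applies welded D D' | applies mu D D']).

Section Quotient.
Variables (mu : move) (n : nat).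

(* The boolean relation needed by [{eq_quot _}], by classical logic. *)
Definition equivalentb (D D' : gauss n) : bool := `[< equivalent mu D D' >].

Lemma equivalentb_refl : reflexive equivalentb.
Proof. by move=> D; apply/asboolP; exact: rst_refl. Qed.
Lemma equivalentb_sym : symmetric equivalentb.
Proof. by move=> D E; apply/asboolP/asboolP; exact: rst_sym. Qed.
Lemma equivalentb_trans : transitive equivalentb.
Proof.
move=> E D F /asboolP DE /asboolP EF; apply/asboolP.
exact: rst_trans DE EF.
Qed.

Canonical equivalentb_equiv :=
  EquivRel equivalentb equivalentb_refl equivalentb_sym equivalentb_trans.

(* The set wSL_n^mu. *)
Definition wSL := {eq_quot equivalentb}.
HB.instance Definition _ := Choice.on wSL.
HB.instance Definition _ := EqQuotient.on wSL.

Lemma wSLP (D E : gauss n) : \pi_wSL D = \pi_wSL E <-> equivalent mu D E.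
Proof.
split=> [/eqP|DE]; first by rewrite piE => /asboolP.
by apply/eqP; rewrite piE; apply/asboolP.
Qed.
End Quotient.

Section Stacking.
Variable n : nat.
Implicit Types D E F : gauss n.

Local Notation even_name := double.
Local Notation odd_name := (fun m => m.*2.+1).

(* The arrows are renamed so that the two diagrams have no common name. *)
Definition stack_code (c d : code n) : code n :=
  [ffun i => map (relabel even_name) (c i) ++ map (relabel odd_name) (d i)].

Lemma mem_endpoints (c : code n) e i : e \in c i -> e \in endpoints c.
Proof.
move=> eci; apply/flattenP; exists (c i) => //.
by apply/mapP; exists i; rewrite ?mem_enum.
Qed.

Lemma stack_endpoints (c d : code n) :
  perm_eq (endpoints (stack_code c d))
    (map (relabel even_name) (endpoints c)
       ++ map (relabel odd_name) (endpoints d)).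
Proof.
rewrite /endpoints; elim: (enum _) => //= i s IHs; rewrite ffunE !map_cat.
rewrite -!catA perm_cat2l perm_sym perm_catCA perm_cat2l perm_sym.
exact: IHs.
Qed.

Lemma even_name_inj : injective even_name. Proof. exact: double_inj. Qed.
Lemma odd_name_inj : injective odd_name.
Proof. by move=> x y [/double_inj]. Qed.

Lemma relabel_inj f : injective f -> injective (relabel f).
Proof. by move=> fI [a h s] [b k t] [/fI -> -> ->]. Qed.

Lemma stack_codeP (c d : code n) :
  gauss_code c -> gauss_code d -> gauss_code (stack_code c d).
Proof.
have pcd := stack_endpoints c d.
case/andP=> uc ac /andP[ud ad]; apply/andP; split.
  rewrite (perm_uniq (perm_map _ pcd)) map_cat cat_uniq -!map_comp.
  have key f w : injective f ->
      uniq [seq (arrow e, is_head e) | e <- w] ->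
      uniq [seq (arrow e, is_head e) | e <- map (relabel f) w].
    move=> fI uw; rewrite -map_comp.
    rewrite (@eq_map _ _ _ ((fun x => (f x.1, x.2)) \o
                            (fun e => (arrow e, is_head e)))) // map_comp.
    by rewrite map_inj_uniq // => -[a h] [b k] [/fI -> ->].
  have := key _ _ even_name_inj uc; have := key _ _ odd_name_inj ud.
  rewrite -!map_comp => -> ->; rewrite andbT /=.
  by apply/hasPn => _ /mapP[e _ ->] /=; apply/mapP => -[f _ [] ]; lia.
apply/allP => e; rewrite !(perm_mem pcd) !mem_cat.
case/orP => /mapP[x xin ->]; apply/orP; [left|right].
  by apply/mapP; exists (flip x) => //; exact: (allP ac).
by apply/mapP; exists (flip x) => //; exact: (allP ad).
Qed.

Definition stack D E : gauss n := Gauss (stack_codeP (gauss_valP D) (gauss_valP E)).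

Lemma empty_codeP : gauss_code ([ffun=> [::]] : code n).
Proof.
suff e0 : endpoints ([ffun=> [::]] : code n) = [::] by rewrite /gauss_code e0.
by rewrite /endpoints; elim: (enum _) => //= i s ->; rewrite ffunE.
Qed.

Definition empty_diagram : gauss n := Gauss empty_codeP.

Lemma stackE D E i : stack D E i =
  map (relabel even_name) (D i) ++ map (relabel odd_name) (E i).
Proof. by rewrite /= ffunE. Qed.

Lemma map_relabel_comp f g (w : word) :
  map (relabel f) (map (relabel g) w) = map (relabel (f \o g)) w.
Proof. by rewrite -map_comp; exact: eq_map. Qed.

Lemma eq_map_relabel f g (w : word) :
  f =1 g -> map (relabel f) w = map (relabel g) w.
Proof. by move=> fg; apply: eq_map => e; rewrite /relabel fg. Qed.

Lemma same_diagram_stackl D D' E :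
  same_diagram D D' -> same_diagram (stack D E) (stack D' E).
Proof.
case=> f fI DD'; exists (fun m => if odd m then m else (f m./2).*2).
  move=> x y; case: ifP => ox; case: ifP => oy //; try by lia.
  by move=> /double_inj/fI; lia.
move=> i; rewrite !stackE DD' map_cat !map_relabel_comp; congr (_ ++ _).
  by apply: eq_map_relabel => m /=; rewrite odd_double doubleK.
by apply: eq_map_relabel => m /=; rewrite odd_double.
Qed.

Lemma same_diagram_stackr D E E' :
  same_diagram E E' -> same_diagram (stack D E) (stack D E').
Proof.
case=> f fI EE'; exists (fun m => if odd m then (f m./2).*2.+1 else m).
  move=> x y; case: ifP => ox; case: ifP => oy //; try by lia.
  by move=> [/double_inj/fI]; lia.
move=> i; rewrite !stackE EE' map_cat !map_relabel_comp; congr (_ ++ _).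
  by apply: eq_map_relabel => m /=; rewrite odd_double.
by apply: eq_map_relabel => m /=; rewrite odd_double uphalf_double.
Qed.

Definition relabel_slot f (x : endpoint + nat) : endpoint + nat :=
  match x with inl e => inl (relabel f e) | inr h => inr h end.

Lemma fill_relabel f (c : template n) p i :
  fill (fun i => map (relabel_slot f) (c i)) [seq map (relabel f) w | w <- p] i
  = map (relabel f) (fill c p i).
Proof.
rewrite !ffunE; elim: (c i) => //= x s ->; rewrite map_cat; congr (_ ++ _).
case: x => //= h; case: (ltnP h (size p)) => hp; first by rewrite (nth_map [::]).
by rewrite !nth_default ?size_map.
Qed.

Lemma holes_ext (c d : template n) :
  (forall i, pmap (fun x => if x is inr h then Some h else None) (c i) =
             pmap (fun x => if x is inr h then Some h else None) (d i)) ->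
  holes c = holes d.
Proof. by move=> cd; rewrite /holes; congr flatten; apply: eq_map. Qed.

Lemma pmap_slot f (s : seq (endpoint + nat)) :
  pmap (fun x => if x is inr h then Some h else None) (map (relabel_slot f) s) =
  pmap (fun x => if x is inr h then Some h else None) s.
Proof. by elim: s => //= -[e|h] s /= ->. Qed.

Lemma pmap_inl (w : word) :
  pmap (fun x : endpoint + nat => if x is inr h then Some h else None)
       (map inl w) = [::].
Proof. by elim: w. Qed.

Lemma fill_inl (w : word) p :
  flatten [seq match x with inl e => [:: e] | inr h => nth [::] p h end
          | x <- [seq inl e : endpoint + nat | e <- w]] = w.
Proof. by elim: w => //= e w ->. Qed.

Lemma applies_stackl r D D' E : relabel_stable r ->
  applies r D D' -> applies r (stack D E) (stack D' E).
Proof.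
move=> rP [c [p [q [rpq hc Dp D'q]]]].
pose cE : template n := fun i => map (relabel_slot even_name) (c i)
  ++ [seq inl e | e <- map (relabel odd_name) (E i)].
exists cE, [seq map (relabel even_name) w | w <- p],
  [seq map (relabel even_name) w | w <- q]; split.
- exact: rP even_name_inj rpq.
- rewrite size_map (@holes_ext cE c) // => i.
  by rewrite pmap_cat pmap_slot pmap_inl cats0.
- apply/ffunP => i; rewrite stackE [RHS]ffunE map_cat flatten_cat fill_inl.
  by congr (_ ++ _); rewrite Dp -fill_relabel [LHS]ffunE.
- apply/ffunP => i; rewrite stackE [RHS]ffunE map_cat flatten_cat fill_inl.
  by congr (_ ++ _); rewrite D'q -fill_relabel [LHS]ffunE.
Qed.

Lemma applies_stackr r D E E' : relabel_stable r ->
  applies r E E' -> applies r (stack D E) (stack D E').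
Proof.
move=> rP [c [p [q [rpq hc Ep E'q]]]].
pose Dc : template n := fun i => [seq inl e | e <- map (relabel even_name) (D i)]
  ++ map (relabel_slot odd_name) (c i).
exists Dc, [seq map (relabel odd_name) w | w <- p],
  [seq map (relabel odd_name) w | w <- q]; split.
- exact: rP odd_name_inj rpq.
- rewrite size_map (@holes_ext Dc c) // => i.
  by rewrite pmap_cat pmap_slot pmap_inl.
- apply/ffunP => i; rewrite stackE [RHS]ffunE map_cat flatten_cat fill_inl.
  by congr (_ ++ _); rewrite Ep -fill_relabel [LHS]ffunE.
- apply/ffunP => i; rewrite stackE [RHS]ffunE map_cat flatten_cat fill_inl.
  by congr (_ ++ _); rewrite E'q -fill_relabel [LHS]ffunE.
Qed.

Lemma equivalent_stack (mu : move) D D' E E' :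
  equivalent mu D D' -> equivalent mu E E' ->
  equivalent mu (stack D E) (stack D' E').
Proof.
move=> DD' EE'; apply: (@rst_trans _ _ _ (stack D' E)).
  elim: DD' => {D D'} [D D' H|D|D D' _|D F D' _ H1 _ H2].
  - apply: rst_step; case: H => H; [constructor 1|constructor 2|constructor 3].
    + exact: same_diagram_stackl.
    + exact: applies_stackl welded_stable H.
    + exact: applies_stackl (@moveP mu) H.
  - exact: rst_refl.
  - exact: rst_sym.
  - exact: rst_trans H1 H2.
elim: EE' => {E E'} [E E' H|E|E E' _|E F E' _ H1 _ H2].
- apply: rst_step; case: H => H; [constructor 1|constructor 2|constructor 3].
  + exact: same_diagram_stackr.
  + exact: applies_stackr welded_stable H.
  + exact: applies_stackr (@moveP mu) H.
- exact: rst_refl.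
- exact: rst_sym.
- exact: rst_trans H1 H2.
Qed.

Lemma stackA D E F :
  same_diagram (stack (stack D E) F) (stack D (stack E F)).
Proof.
exists (fun m => if odd m then m.*2.+1 else if odd m./2 then m.-1 else m./2).
  by move=> x y /=; do 4?case: ifP; lia.
move=> i; rewrite !stackE !map_cat !map_relabel_comp -catA.
congr (_ ++ (_ ++ _)); apply: eq_map_relabel => m /=.
- by rewrite !odd_double !doubleK odd_double.
- by rewrite !odd_double !doubleK /= odd_double.
- by rewrite odd_double.
Qed.

Lemma stack0D D : same_diagram D (stack empty_diagram D).
Proof.
exists odd_name; first exact: odd_name_inj.
by move=> i; rewrite stackE /= ffunE.
Qed.

Lemma stackD0 D : same_diagram D (stack D empty_diagram).
Proof.
exists even_name; first exact: even_name_inj.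
by move=> i; rewrite stackE /= ffunE cats0.
Qed.

End Stacking.

Section Monoid.
Variables (mu : move) (n : nat).
Local Notation Q := (wSL mu n).

Definition wSL_mul (x y : Q) : Q := \pi_Q (stack (repr x) (repr y)).
Definition wSL_one : Q := \pi_Q (empty_diagram n).

Lemma pi_stack (D E : gauss n) :
  \pi_Q (stack D E) = wSL_mul (\pi_Q D) (\pi_Q E).
Proof.
by apply/wSLP; apply: equivalent_stack; apply/wSLP; rewrite reprK.
Qed.

Lemma same_diagram_pi (D E : gauss n) : same_diagram D E -> \pi_Q D = \pi_Q E.
Proof. by move=> DE; apply/wSLP; apply: rst_step; constructor 1. Qed.

Lemma wSL_mulA : associative wSL_mul.
Proof.
elim/quotW => D; elim/quotW => E; elim/quotW => F.
rewrite -(pi_stack E F) -(pi_stack D E) -(pi_stack D (stack E F)).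
rewrite -(pi_stack (stack D E) F); apply/esym/same_diagram_pi; exact: stackA.
Qed.

Lemma wSL_mul1g : left_id wSL_one wSL_mul.
Proof.
elim/quotW => D; rewrite -(pi_stack (empty_diagram n) D).
by apply/esym/same_diagram_pi; exact: stack0D.
Qed.

Lemma wSL_mulg1 : right_id wSL_one wSL_mul.
Proof.
elim/quotW => D; rewrite -(pi_stack D (empty_diagram n)).
by apply/esym/same_diagram_pi; exact: stackD0.
Qed.

HB.instance Definition _ :=
  isMonoid.Build Q wSL_mulA wSL_mul1g wSL_mulg1.

End Monoid.

(* Meant for i != j; [flip e] is the other endpoint of the arrow of [e]. *)
Definition vlk n (i j : 'I_n) (D : gauss n) : int :=
  (\sum_(e <- D i | ~~ is_head e && (flip e \in D j)) sgn (positive e))%R.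

Definition upair (n : nat) := {p : 'I_n * 'I_n | p.1 < p.2}.

Definition vlk_sym n (D : gauss n) : {ffun upair n -> int} :=
  [ffun p => (vlk (val p).1 (val p).2 D + vlk (val p).2 (val p).1 D)%R].

Lemma card_upair n : #|{: upair n}| = (n * n.-1)./2.
Proof.
rewrite card_sig -sum1_card.
rewrite -(pair_big_dep xpredT (fun i j : 'I_n => i < j) (fun _ _ => 1)) /=.
rewrite (exchange_big_dep xpredT) //= -bin2 -bin2_sum big_mkord.
by apply: eq_bigr => j _; rewrite (big_ord_narrow (ltnW (ltn_ord j))) sum1_card card_ord.
Qed.

(* Main.v *)
From HB Require Import structures.
From Stdlib Require Import Relations.
From mathcomp Require Import all_boot all_order all_algebra.
From mathcomp Require Import boolp zify.
Require Import Defs.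

(** Under VC the direction of an arrow carries no information, and this makes
    the order of the endpoints along each strand irrelevant too. To exchange
    two adjacent endpoints of different arrows, reverse arrows until both
    endpoints are tails, apply OC, and reverse back ([swap_equiv]); if they
    belong to the same arrow, VC itself exchanges them. Hence a diagram is
    determined, up to equivalence, by the set of endpoints on each strand
    ([perm_equiv]), that is, by a multiset of signed arrows, each joining an
    unordered pair of strands.

    Taking one arrow out of a diagram therefore writes it as the stacking of a
    smaller diagram and a one-arrow diagram ([extract_arrow]), so one-arrow
    diagrams generate wSL_n^VC. They commute ([stackC]); those with both ends
    on one strand are trivial by R1, those from i to j and from j to i agree by
    VC, and opposite signs cancel by R2. So wSL_n^VC is an abelian group
    generated by one positive arrow [generator p] for each pair p of distinct
    strands, and [realize], which sends an integer vector to the corresponding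
    combination of generators, is onto. The invariant takes [generator p] to
    the p-th basis vector, so it is a left inverse of [realize], and the two
    maps are inverse to each other ([realizeK], [wvlkK]).

    For the invariance, vlk_ij + vlk_ji is read as one sum over the endpoints
    on strand i whose partner lies on strand j ([lk], [vlk_symE]). That sum
    depends only on the set of endpoints on each strand, so R3 and OC preserve
    it, and it is additive in the set of arrows ([lk_split]), so R1, R2 and VC
    are computed on the arrows that they involve ([lk_fill]). The same
    additivity shows that it is a morphism for stacking ([vlk_stack]). *)

Set Implicit Arguments.
Unset Strict Implicit.
Unset Printing Implicit Defensive.

Import GRing.Theory.

Local Open Scope quotient_scope.

(** * Families of words *)

Section Families.
Variables (I T : eqType).
Implicit Types (F G H : I -> seq T) (s : seq I).

Lemma perm_flatten_cat F G H s :
  (forall i, perm_eq (F i) (G i ++ H i)) ->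
  perm_eq (flatten (map F s)) (flatten (map G s) ++ flatten (map H s)).
Proof.
move=> FGH; elim: s => //= i s IHs.
apply: perm_trans (perm_cat (FGH i) IHs) _.
by rewrite -!catA perm_cat2l perm_catCA.
Qed.

Lemma flatten_uniq_inj F s x i j :
  uniq (flatten (map F s)) -> i \in s -> j \in s ->
  x \in F i -> x \in F j -> i = j.
Proof.
elim: s => //= k s IHs; rewrite cat_uniq => /and3P[_ /hasPn dis us].
have sub l : l \in s -> x \in F l -> x \in flatten (map F s).
  by move=> ls xl; apply/flatten_mapP; exists l.
rewrite !inE => /orP[/eqP-> | si] /orP[/eqP-> | sj] // xi xj.
- by have := dis _ (sub _ sj xj); rewrite /= xi.
- by have := dis _ (sub _ si xi); rewrite /= xj.
- exact: IHs.
Qed.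

Lemma flatten_uniq_strand F s i :
  i \in s -> uniq (flatten (map F s)) -> uniq (F i).
Proof.
elim: s => //= k s IHs; rewrite inE cat_uniq => /orP[/eqP-> | si] /and3P[] //.
by move=> _ _; exact: IHs.
Qed.

Lemma flatten_at s i (w : seq T) :
  uniq s -> i \in s -> flatten [seq if k == i then w else [::] | k <- s] = w.
Proof.
have nil t : i \notin t -> flatten [seq if k == i then w else [::] | k <- t] = [::].
  by elim: t => //= k t IHt; rewrite inE negb_or eq_sym => /andP[/negbTE-> /IHt].
elim: s => //= k s IHs /andP[ks us]; rewrite inE => /orP[/eqP ik | si].
  by rewrite ik eqxx -ik nil ?cats0 // ik.
by case: eqP => [ki|_]; [rewrite ki si in ks | rewrite IHs].
Qed.

End Families.

(** * Gauss codes and their endpoints *)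

Section Codes.
Variable n : nat.
Implicit Types (c d C P : code n) (D E : gauss n) (i j : 'I_n).

Lemma mem_endpointsP c e : reflect (exists i, e \in c i) (e \in endpoints c).
Proof.
apply: (iffP flatten_mapP) => [[i _ ei] | [i ei]]; first by exists i.
by exists i; rewrite ?mem_enum.
Qed.

Lemma endpoints_cat c C P : (forall i, perm_eq (c i) (C i ++ P i)) ->
  perm_eq (endpoints c) (endpoints C ++ endpoints P).
Proof. exact: perm_flatten_cat. Qed.

Lemma endpoints_perm c d : (forall i, perm_eq (c i) (d i)) ->
  perm_eq (endpoints c) (endpoints d).
Proof.
move=> cd; have := @endpoints_cat c d [ffun=> [::]].
have -> : endpoints ([ffun=> [::]] : code n) = [::].
  by rewrite /endpoints; elim: (enum _) => //= i s ->; rewrite ffunE.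
by rewrite cats0; apply=> i; rewrite ffunE cats0.
Qed.

Lemma flipK : involutive flip.
Proof. by case=> a h s; rewrite /flip /= negbK. Qed.

Lemma gauss_code_perm c d :
  perm_eq (endpoints c) (endpoints d) -> gauss_code c -> gauss_code d.
Proof.
move=> cd /andP[uc ac]; apply/andP; split.
  by rewrite -(perm_uniq (perm_map _ cd)).
by apply/allP => e; rewrite -!(perm_mem cd); exact: (allP ac).
Qed.

Lemma gauss_eq D E : (forall i, D i = E i) -> D = E.
Proof. by move=> DE; apply/val_inj/ffunP. Qed.

Lemma gauss_uniq D : uniq (endpoints D).
Proof. by case/andP: (gauss_valP D) => /map_uniq. Qed.

Lemma gauss_flip D e : e \in endpoints D -> flip e \in endpoints D.
Proof. by case/andP: (gauss_valP D) => _ /allP; exact. Qed.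

Lemma gauss_inj D :
  {in endpoints D &, injective (fun e => (arrow e, is_head e))}.
Proof.
case/andP: (gauss_valP D) => + _; elim: (endpoints D) => //= x w IHw.
case/andP=> xw uw e f; rewrite !inE => /orP[/eqP->|ew] /orP[/eqP->|fw] // ef.
- by case/negP: xw; rewrite ef; apply: map_f.
- by case/negP: xw; rewrite -ef; apply: map_f.
- exact: IHw.
Qed.

Lemma same_arrow D e f : e \in endpoints D -> f \in endpoints D ->
  arrow e = arrow f -> f = e \/ f = flip e.
Proof.
move=> eD fD ef; have [hef|hef] := eqVneq (is_head f) (is_head e).
  by left; apply: gauss_inj fD eD _; rewrite ef hef.
right; apply: gauss_inj fD (gauss_flip eD) _; rewrite /= ef.
by case: (is_head e) hef; case: (is_head f).
Qed.

Lemma gauss_strand_uniq D i : uniq (D i).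
Proof. by apply: flatten_uniq_strand (gauss_uniq D); rewrite mem_enum. Qed.

Lemma gauss_strand_inj D i j e : e \in D i -> e \in D j -> i = j.
Proof. by apply: flatten_uniq_inj (gauss_uniq D) _ _; rewrite mem_enum. Qed.

(** * Linking numbers of codes *)

(** Every endpoint on strand i is counted, whatever its nature, so that for
    i != j this single sum is vlk_ij + vlk_ji; and it is defined on arbitrary
    codes so as to apply to parts of a diagram. *)
Definition lk i j c : int :=
  (\sum_(e <- c i | flip e \in c j) sgn (positive e))%R.

Lemma vlk_symE D p : vlk_sym D p = lk (val p).1 (val p).2 D.
Proof.
rewrite ffunE; case: (val p) => i j /= {p}.
rewrite /lk (bigID (fun e => ~~ is_head e)) /=; congr (_ + _)%R.
  by apply: eq_bigl => e; rewrite andbC.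
(* Sum over the heads on strand i instead of over their tails on strand j. *)
rewrite /vlk -[LHS]big_filter -[RHS]big_filter.
rewrite -[LHS](big_map flip xpredT (fun e => sgn (positive e))).
apply/perm_big/uniq_perm; first last.
- move=> e; rewrite mem_filter -[e in LHS]flipK (mem_map (inv_inj flipK)).
  by rewrite mem_filter flipK /= andbC andbA.
- exact/filter_uniq/gauss_strand_uniq.
- by rewrite (map_inj_uniq (inv_inj flipK)); apply/filter_uniq/gauss_strand_uniq.
Qed.

Lemma lk_perm i j c d : (forall k, perm_eq (c k) (d k)) -> lk i j c = lk i j d.
Proof.
move=> cd; rewrite /lk (perm_big _ (cd i)).
by apply: eq_bigl => e; rewrite (perm_mem (cd j)).
Qed.

(** If [P] consists of whole arrows then, endpoints being distinct, no arrow of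
    [D] joins [C] to [P]. *)
Lemma lk_split i j D C P : (forall k, perm_eq (D k) (C k ++ P k)) ->
  (forall e, e \in endpoints P -> flip e \in endpoints P) ->
  lk i j D = (lk i j C + lk i j P)%R.
Proof.
move=> DCP Pflip; rewrite /lk (perm_big _ (DCP i)) big_cat /=.
have := gauss_uniq D; rewrite (perm_uniq (endpoints_cat DCP)) cat_uniq.
case/and3P=> _ /hasPn dis _.
congr (_ + _)%R; rewrite [LHS]big_seq_cond [RHS]big_seq_cond;
  apply: eq_bigl => e; rewrite (perm_mem (DCP j)) mem_cat;
  case: (boolP (e \in _)) => //= ei.
- case: (boolP (flip e \in P j)) => [/mem_endpoints/Pflip|_]; last by rewrite orbF.
  by rewrite flipK => /dis /=; rewrite (mem_endpoints ei).
- case: (boolP (flip e \in C j)) => // fe.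
  by have := dis _ (Pflip _ (mem_endpoints ei)); rewrite /= (mem_endpoints fe).
Qed.

(** * Splitting a diagram along the portions of a move *)

Definition slot_holes (s : seq (endpoint + nat)) : seq nat :=
  pmap (fun x => if x is inr h then Some h else None) s.
Definition slot_fixed (s : seq (endpoint + nat)) : word :=
  pmap (fun x => if x is inl e then Some e else None) s.

Lemma fill_perm (c : template n) p i :
  perm_eq (fill c p i)
    (slot_fixed (c i) ++ flatten [seq nth [::] p h | h <- slot_holes (c i)]).
Proof.
rewrite ffunE /slot_fixed /slot_holes; elim: (c i) => //= -[e|h] s /= IHs.
  by rewrite perm_cons.
by rewrite perm_sym perm_catCA perm_cat2l perm_sym.
Qed.

(** What the portions [p] of a local move contribute to each strand, when the
    h-th portion lies on strand [k h]. *)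
Definition content (k : nat -> 'I_n) (p : seq word) : code n :=
  [ffun i => flatten [seq nth [::] p h | h <- iota 0 (size p) & k h == i]].

Lemma mem_content k p e : (e \in endpoints (content k p)) = (e \in flatten p).
Proof.
apply/mem_endpointsP/flattenP => [[i] | [w /(nthP [::])[h hp <-] eh]].
  rewrite ffunE => /flatten_mapP[h]; rewrite mem_filter mem_iota /=.
  by move=> /andP[_ hp] eh; exists (nth [::] p h); rewrite ?mem_nth.
exists (k h); rewrite ffunE; apply/flatten_mapP; exists h => //.
by rewrite mem_filter eqxx mem_iota.
Qed.

(** Since the portions occur exactly once, each has a well defined strand; [i0]
    is the default value of [k] at indices that name no portion. *)
Lemma holes_strand (i0 : 'I_n) (c : template n) m :
  perm_eq (holes c) (iota 0 m) ->
  exists k : nat -> 'I_n,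
    forall i, perm_eq (slot_holes (c i)) [seq h <- iota 0 m | k h == i].
Proof.
move=> hc; have uh : uniq (holes c) by rewrite (perm_uniq hc) iota_uniq.
exists (fun h => odflt i0 [pick i | h \in slot_holes (c i)]) => i.
apply: uniq_perm.
- by apply: flatten_uniq_strand uh; rewrite mem_enum.
- exact/filter_uniq/iota_uniq.
- move=> h; rewrite mem_filter -(perm_mem hc).
  case: pickP => [j hj | none] /=.
    apply/idP/andP => [hi | [/eqP<-] //]; split.
      by apply/eqP; apply: flatten_uniq_inj uh _ _ hj hi; rewrite mem_enum.
    by apply/flatten_mapP; exists i; rewrite ?mem_enum.
  rewrite none; apply/esym/negP => /andP[_ /flatten_mapP[j _]].
  by have := none j; rewrite /slot_holes => ->.
Qed.

(** For a move that replaces whole arrows by whole arrows, the part of the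
    diagram outside the portions contributes the same amount on both sides, so
    only the contents of the portions have to be compared. *)
Lemma lk_fill i j (c : template n) p q D E :
  perm_eq (holes c) (iota 0 (size p)) -> size q = size p ->
  (forall e, e \in flatten p -> flip e \in flatten p) ->
  (forall e, e \in flatten q -> flip e \in flatten q) ->
  (forall k, lk i j (content k p) = lk i j (content k q)) ->
  gauss_val D = fill c p -> gauss_val E = fill c q ->
  lk i j D = lk i j E.
Proof.
move=> hc qp fp fq lkpq Dp Eq; have [k ck] := holes_strand i hc.
pose C : code n := [ffun l => slot_fixed (c l)].
have split r : size r = size p -> forall l,
    perm_eq (fill c r l) (C l ++ content k r l).
  move=> rp l; apply: perm_trans (fill_perm _ _ _) _; rewrite !ffunE rp.
  by rewrite perm_cat2l; apply/perm_flatten/perm_map.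
rewrite (@lk_split i j D C (content k p)) ?(@lk_split i j E C (content k q)) //.
- by rewrite lkpq.
- by move=> l; rewrite Eq; exact: split.
- by move=> e; rewrite !mem_content; exact: fq.
- by move=> l; rewrite Dp; exact: split.
- by move=> e; rewrite !mem_content; exact: fp.
Qed.

Lemma fill_perm_nth (c : template n) p q i :
  (forall h, perm_eq (nth [::] p h) (nth [::] q h)) ->
  perm_eq (fill c p i) (fill c q i).
Proof.
move=> pq; rewrite !ffunE; elim: (c i) => //= -[e|h] s IHs /=.
  by rewrite perm_cons.
exact: perm_cat.
Qed.

Lemma perm_ord2 o x y : perm_eq (ord2 o x y) [:: x; y].
Proof. by case: o => //; rewrite (perm_catC [:: y]). Qed.

Lemma endpoint_eqE a b s t h k : (Endpoint a h s == Endpoint b k t) =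
  [&& a == b, h == k & s == t].
Proof.
by apply/eqP/and3P => [[-> -> ->] | [/eqP-> /eqP-> /eqP->]]; rewrite ?eqxx.
Qed.

End Codes.

(** * The moves preserve linking numbers *)

Section Invariance.
Variable n : nat.
Implicit Types (c d C P : code n) (D E : gauss n) (i j : 'I_n).

Lemma same_diagram_vlk D E : same_diagram D E -> vlk_sym D = vlk_sym E.
Proof.
case=> f fI DE; apply/ffunP => p; rewrite !vlk_symE /lk.
rewrite [X in _ = X](_ : _ = \sum_(e <- map (relabel f) (D (val p).1)
   | flip e \in map (relabel f) (D (val p).2)) sgn (positive e))%R; last first.
  by rewrite -!DE.
rewrite big_map; apply: eq_bigl => e.
by rewrite -[flip (relabel f e)]/(relabel f (flip e)) (mem_map (relabel_inj fI)).
Qed.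

(** A self-arrow created by R1 does not count since i != j, the two arrows
    created by R2 have opposite signs and the same end strands, and R3 and OC
    only permute the endpoints inside each portion. *)
Lemma lk_welded i j D E : i != j -> applies welded D E -> lk i j D = lk i j E.
Proof.
move=> ij [c [p [q [r hc Dp Eq]]]].
have lknil k m : lk i j (content k (nseq m [::])) = 0%R.
  rewrite /lk [content _ _ i]ffunE size_nseq big1_seq // => e /andP[_].
  by case/flatten_mapP=> h _; rewrite nth_nseq if_same.
case: r hc Dp Eq =>
  [a s o|a b s o1 o2|a12 a23 a13 s12 s23 s13 o1 o2 o3 _ _|a b s t] hc Dp Eq.
- apply: (lk_fill hc) Dp Eq => //.
    move=> e /=; rewrite cats0 !(perm_mem (perm_ord2 _ _ _)) !inE => /orP[]/eqP->;
    by rewrite eqxx ?orbT.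
  move=> k; rewrite (lknil k 1) /lk !ffunE /=.
  have [ki|ki] := eqVneq (k 0) i; last by rewrite big_nil.
  by rewrite -ki in ij; rewrite (negbTE ij) big1.
- apply: (lk_fill hc) Dp Eq => //.
    move=> e /=; rewrite cats0 !mem_cat !(perm_mem (perm_ord2 _ _ _)) !inE.
    by move=> /orP[]/orP[]/eqP->; rewrite eqxx ?orbT.
  move=> k; rewrite (lknil k 2) (@lk_perm _ _ _ _
    [ffun l => (if k 0 == l then [:: tail a s; tail b (~~ s)] else [::])
             ++ (if k 1 == l then [:: head a s; head b (~~ s)] else [::])]);
    last first.
    move=> l; rewrite !ffunE /=.
    do 2!case: ifP => _; rewrite /= ?cats0 ?perm_ord2 //.
    exact: perm_cat (perm_ord2 _ _ _) (perm_ord2 _ _ _).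
  rewrite /lk !ffunE big_cat /=.
  have [k0i|k0i] := eqVneq (k 0) i; have [k1i|k1i] := eqVneq (k 1) i.
  + rewrite k0i k1i (negbTE ij) !big1 //; by move=> e; rewrite in_nil.
  + rewrite k0i (negbTE ij) big_nil addr0 /=.
    case: ifP => _; last by rewrite big1.
    rewrite !big_cons big_nil /= !inE /flip /= !endpoint_eqE !eqxx !orbT.
    by case: (s).
  + rewrite k1i (negbTE ij) big_nil add0r cats0 /=.
    case: ifP => _; last by rewrite big1.
    rewrite !big_cons big_nil /= !inE /flip /= !endpoint_eqE !eqxx !orbT.
    by case: (s).
  + by rewrite !big_nil.
- rewrite Dp Eq; apply: lk_perm => l; apply: fill_perm_nth => -[|[|[|h]]] //=;
  by apply: perm_trans (perm_ord2 _ _ _) _; rewrite perm_sym perm_ord2.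
- rewrite Dp Eq; apply: lk_perm => l; apply: fill_perm_nth => -[|h] //=.
  by rewrite (perm_catC [:: _] [:: _]).
Qed.

Lemma lk_VC i j D E : i != j -> applies VC D E -> lk i j D = lk i j E.
Proof.
move=> ij [c [p [q [r hc Dp Eq]]]].
case: r hc Dp Eq => a s hc Dp Eq; apply: (lk_fill hc) Dp Eq => //.
- by move=> e /=; rewrite !inE => /orP[]/eqP->; rewrite eqxx ?orbT.
- by move=> e /=; rewrite !inE => /orP[]/eqP->; rewrite eqxx ?orbT.
move=> k; rewrite /lk !ffunE /=.
have [k0i|k0i] := eqVneq (k 0) i; have [k1i|k1i] := eqVneq (k 1) i;
  rewrite /= ?k0i ?k1i ?(negbTE ij) /= ?cats0 ?big_nil //.
- by rewrite !big1.
- by case: ifP => _; rewrite !big_cons !big_nil /= ?inE /flip /= ?eqxx.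
- by case: ifP => _; rewrite !big_cons !big_nil /= ?inE /flip /= ?eqxx.
Qed.

Lemma upair_neq (p : upair n) : (val p).1 != (val p).2.
Proof. by case: p => -[i j] /= ij; rewrite neq_ltn ij. Qed.

Lemma equivalent_vlk D E : equivalent VC D E -> vlk_sym D = vlk_sym E.
Proof.
elim=> {D E} [D E [H|H|H]|//|D E _ -> //|D F E _ -> _ -> //].
- exact: same_diagram_vlk.
- by apply/ffunP => p; rewrite !vlk_symE; apply: lk_welded (upair_neq p) H.
- by apply/ffunP => p; rewrite !vlk_symE; apply: lk_VC (upair_neq p) H.
Qed.

(** The two factors of a stacking share no arrow. *)
Lemma vlk_stack D E : vlk_sym (stack D E) = (vlk_sym D + vlk_sym E)%R.
Proof.
apply/ffunP => p; rewrite [RHS]ffunE !vlk_symE.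
pose DC f (d : code n) : code n := [ffun i => map (relabel f) (d i)].
have lkf f (d : code n) i j : injective f -> lk i j (DC f d) = lk i j d.
  move=> fI; rewrite /lk !ffunE big_map; apply: eq_bigl => e.
  by rewrite -[flip (relabel f e)]/(relabel f (flip e)) (mem_map (relabel_inj fI)).
rewrite (@lk_split _ _ _ _ (DC double D) (DC (fun m => m.*2.+1) E)).
- by rewrite !lkf //; [exact: odd_name_inj | exact: even_name_inj].
- by move=> k; rewrite stackE !ffunE.
- move=> e /mem_endpointsP[i]; rewrite ffunE => /mapP[x xi ->].
  have /mem_endpointsP[j xj] := gauss_flip (mem_endpoints xi).
  apply/mem_endpointsP; exists j; rewrite ffunE.
  exact: (map_f (relabel _) xj).
Qed.

End Invariance.

(** * Endpoints commute modulo VC *)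

Section Reordering.
Variable n : nat.
Implicit Types (c d : code n) (D E : gauss n) (i j : 'I_n).

Local Notation equiv := (@equivalent VC n).

Lemma welded_equiv D E : applies welded D E -> equiv D E.
Proof. by move=> H; apply: rst_step; constructor 2. Qed.

Lemma VC_equiv D E : applies VC D E -> equiv D E.
Proof. by move=> H; apply: rst_step; constructor 3. Qed.

Definition letters (w : word) : seq (endpoint + nat) := map inl w.

(** A local move all of whose portions are consecutive on one strand; [m] lists
    the portions in the order in which they are met. *)
Lemma applies_strand (r : rule) p q D E i u v m :
  r p q -> perm_eq m (iota 0 (size p)) ->
  D i = u ++ flatten [seq nth [::] p h | h <- m] ++ v ->
  E i = u ++ flatten [seq nth [::] q h | h <- m] ++ v ->
  (forall j, j != i -> E j = D j) -> applies r D E.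
Proof.
move=> rpq hm Di Ei DE.
exists (fun j => if j == i then letters u ++ map inr m ++ letters v
                 else letters (D j)), p, q.
have fill_inr (t : seq word) : flatten [seq match x with
      | inl e => [:: e] | inr h => nth [::] t h end
    | x <- [seq inr h : endpoint + nat | h <- m]]
    = flatten [seq nth [::] t h | h <- m] by rewrite -map_comp.
split=> //.
- rewrite /holes (_ : [seq _ | _ <- _] =
      [seq if k == i then m else [::] | k <- enum 'I_n]).
    by rewrite flatten_at ?enum_uniq ?mem_enum.
  apply: eq_map => k; case: eqP => _; last exact: pmap_inl.
  rewrite !pmap_cat !pmap_inl cats0 /=.
  by elim: m {hm Di Ei fill_inr} => //= h m ->.
- apply/ffunP => k; rewrite ffunE; case: eqP => [->|_]; last by rewrite fill_inl.
  by rewrite !map_cat !flatten_cat !fill_inl fill_inr.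
- apply/ffunP => k; rewrite ffunE; case: eqP => [->|/eqP ki].
    by rewrite !map_cat !flatten_cat !fill_inl fill_inr.
  by rewrite fill_inl DE.
Qed.

Definition flip_at a (e : endpoint) := if arrow e == a then flip e else e.

Lemma flip_at_gauss D a :
  gauss_code ([ffun i => map (flip_at a) (D i)] : code n).
Proof.
rewrite /gauss_code (_ : endpoints _ = map (flip_at a) (endpoints D)); last first.
  rewrite /endpoints map_flatten; congr flatten; rewrite -[RHS]map_comp.
  by apply: eq_map => i; rewrite ffunE.
case/andP: (gauss_valP D) => uD _; apply/andP; split.
  rewrite -map_comp (@eq_map _ _ _ ((fun x => (x.1, x.2 (+) (x.1 == a))) \o
                            (fun e => (arrow e, is_head e)))); last first.
    by move=> e /=; rewrite /flip_at; case: eqP => _ /=; rewrite ?addbT ?addbF.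
  rewrite map_comp map_inj_uniq // => -[b h] [b' h'] /= [<-].
  by move=> /addIb ->.
apply/allP => _ /mapP[e eD ->]; apply/mapP; exists (flip e).
  exact: gauss_flip.
by rewrite /flip_at /=; case: ifP.
Qed.

Definition flip_arrow a D : gauss n := Gauss (flip_at_gauss D a).

Lemma flip_arrowE a D i : flip_arrow a D i = map (flip_at a) (D i).
Proof. by rewrite /= ffunE. Qed.

(** VC at the arrow named [a], with one-letter portions around its endpoints;
    if no arrow has this name, the diagram does not change. *)
Lemma flip_arrow_equiv a D : equiv D (flip_arrow a D).
Proof.
have [/hasP[e eD /eqP ea]|no_a] :=
  boolP (has (fun e => arrow e == a) (endpoints D)); last first.
  rewrite (_ : flip_arrow a D = D); first exact: rst_refl.
  apply: gauss_eq => i; rewrite flip_arrowE -[RHS]map_id.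
  apply/eq_in_map => e /mem_endpoints eD; rewrite /flip_at.
  by rewrite (negbTE (hasPn no_a _ eD)).
set t := tail a (positive e); set h := head a (positive e).
have [tD hD] : t \in endpoints D /\ h \in endpoints D.
  have := gauss_flip eD; move: eD; rewrite /t /h -ea.
  by case: e {ea t h} => b [] s /=; split.
have namedE f : f \in endpoints D -> arrow f = a -> f = t \/ f = h.
  by move=> fD fa; apply: (same_arrow tD fD); rewrite fa.
pose slot f : endpoint + nat :=
  if f == t then inr 0 else if f == h then inr 1 else inl f.
have ht : (h == t) = false by rewrite endpoint_eqE andbF.
apply: VC_equiv; exists (fun i => map slot (D i)).
exists [:: [:: t]; [:: h]], [:: [:: h]; [:: t]].
split; first exact: VC_intro.
- pose hole f := if f == t then Some 0 else if f == h then Some 1 else None.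
  rewrite /holes (_ : flatten _ = pmap hole (endpoints D)); last first.
    rewrite /endpoints; elim: (enum _) => //= i s ->; rewrite pmap_cat.
    congr (_ ++ _).
    elim: (D i) => //= f w ->; rewrite /slot /hole.
    by case: (f == t); case: (f == h).
  apply: uniq_perm => //.
    apply: (@pmap_uniq _ _ _ (fun m => if m == 0 then t else h)) (gauss_uniq D).
    by move=> f; rewrite /hole; case: eqP => [->|_]//=; case: eqP => [->|_].
  move=> m; rewrite mem_pmap; apply/mapP/idP => [[f _]|].
    by rewrite /hole; case: ifP => [_ [->]|_] //; case: ifP => [_ [->]|_].
  rewrite !inE => /orP[]/eqP->; [exists t | exists h] => //.
    by rewrite /hole eqxx.
  by rewrite /hole ht eqxx.
- apply/ffunP => i; rewrite ffunE; elim: (D i) => //= f w <-.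
  rewrite /slot; case: eqP => [->|_] //; by case: eqP => [->|_].
- apply/ffunP => i; rewrite flip_arrowE ffunE.
  have : {subset D i <= endpoints D} by move=> f; exact: mem_endpoints.
  elim: (D i) => //= f w IHw sub; rewrite -IHw => [|g gw]; last first.
    by apply: sub; rewrite inE gw orbT.
  have fD : f \in endpoints D by apply: sub; rewrite inE eqxx.
  rewrite /flip_at /slot; case: eqP => [fa|fa].
    have [->|->] := namedE f fD fa; first by rewrite eqxx.
    by rewrite ht eqxx.
  case: eqP => [ft|_]; first by rewrite ft in fa.
  by case: eqP => [fh|_] //; rewrite fh in fa.
Qed.

Lemma equiv_flip_arrow a D E :
  equiv (flip_arrow a D) (flip_arrow a E) -> equiv D E.
Proof.
move=> DE; apply: rst_trans (flip_arrow_equiv a D) _.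
by apply: rst_trans DE _; apply: rst_sym; exact: flip_arrow_equiv.
Qed.

Definition swapped i u x y v D E :=
  [/\ D i = u ++ x :: y :: v, E i = u ++ y :: x :: v
    & forall j, j != i -> E j = D j].

Lemma swapped_flip a i u x y v D E : swapped i u x y v D E ->
  swapped i (map (flip_at a) u) (flip_at a x) (flip_at a y) (map (flip_at a) v)
    (flip_arrow a D) (flip_arrow a E).
Proof.
case=> Di Ei DE; split; rewrite ?flip_arrowE ?Di ?Ei ?map_cat //.
by move=> j ji; rewrite !flip_arrowE DE.
Qed.

Lemma swapped_mem i u x y v D E : swapped i u x y v D E ->
  [/\ x \in endpoints D, y \in endpoints D & x != y].
Proof.
case=> Di _ _; split.
- by apply: (@mem_endpoints _ _ _ i); rewrite Di mem_cat inE eqxx orbT.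
- by apply: (@mem_endpoints _ _ _ i); rewrite Di mem_cat !inE eqxx !orbT.
- have := gauss_strand_uniq D i; rewrite Di cat_uniq => /and3P[_ _] /=.
  by rewrite inE negb_or => /andP[/andP[]].
Qed.

(** OC exchanges tails only; since reversing an arrow is allowed, any endpoint
    can be turned into a tail first. For two ends of one arrow this is
    impossible, but then the exchange is itself an instance of VC. *)
Lemma swap_equiv i u x y v D E : swapped i u x y v D E -> equiv D E.
Proof.
have tails i0 u0 a s b t v0 D0 E0 :
    swapped i0 u0 (tail a s) (tail b t) v0 D0 E0 -> equiv D0 E0.
  case=> Di Ei DE; apply/welded_equiv.
  exact: (@applies_strand welded _ _ _ _ _ u0 v0 [:: 0] (OC a b s t) _ Di Ei DE).
move=> S; have [xD yD xy] := swapped_mem S.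
have [axy|axy] := eqVneq (arrow x) (arrow y).
  have [yx|yE] := same_arrow xD yD axy; first by rewrite yx eqxx in xy.
  case: S => Di Ei DE; rewrite yE in Di Ei; case: x {xD xy axy yE yD} Di Ei.
  move=> a [] s Di Ei.
    apply/rst_sym/VC_equiv.
    have r := VC_intro a s.
    apply: (@applies_strand VC_rule _ _ _ _ _ u v [:: 0; 1] r _ Ei Di) => //.
    by move=> j /DE.
  apply/VC_equiv.
  exact: (@applies_strand VC_rule _ _ _ _ _ u v [:: 0; 1] (VC_intro a s) _ Di Ei).
case: x y {xD yD xy} axy S => a h s [b k t] /= ab S.
have atE m g r : flip_at m (Endpoint m g r) = Endpoint m (~~ g) r.
  by rewrite /flip_at /= eqxx.
have naE m m' g r : m != m' -> flip_at m' (Endpoint m g r) = Endpoint m g r.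
  by rewrite /flip_at /= => /negbTE->.
case: h k S => [] [] S; last exact: tails S.
- apply/(@equiv_flip_arrow a)/(@equiv_flip_arrow b).
  have := swapped_flip b (swapped_flip a S).
  by rewrite atE (naE b a) 1?eq_sym // (naE a b) // atE => /tails.
- apply/(@equiv_flip_arrow a).
  by have := swapped_flip a S; rewrite atE (naE b a) 1?eq_sym // => /tails.
- apply/(@equiv_flip_arrow b).
  by have := swapped_flip b S; rewrite atE (naE a b) // => /tails.
Qed.

Lemma reorder_strand D i w : perm_eq (D i) w ->
  exists E, E i = w /\ forall j, j != i -> E j = D j.
Proof.
move=> Dw; pose c : code n := [ffun j => if j == i then w else D j].
have cP : gauss_code c.
  apply: gauss_code_perm (gauss_valP D); apply: endpoints_perm => j.
  by rewrite ffunE; case: eqP => [->|].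
exists (Gauss cP); rewrite /= ffunE eqxx; split=> // j /negbTE ji.
by rewrite ffunE ji.
Qed.

Lemma same_equiv D E : (forall i, D i = E i) -> equiv D E.
Proof. by move=> /gauss_eq->; exact: rst_refl. Qed.

(** Bubble sort: the letter [x] is carried through [v1] by adjacent exchanges. *)
Lemma move_equiv i v1 u x v2 D E :
  D i = u ++ x :: v1 ++ v2 -> E i = u ++ v1 ++ x :: v2 ->
  (forall j, j != i -> E j = D j) -> equiv D E.
Proof.
elim: v1 u D => [|y v1 IHv] u D Di Ei DE.
  apply: same_equiv => j; have [->|/DE //] := eqVneq j i.
  by rewrite Di Ei.
have [|M [Mi MD]] := @reorder_strand D i (u ++ y :: x :: v1 ++ v2).
  by rewrite Di perm_cat2l (perm_catCA [:: x] [:: y]).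
apply: (@rst_trans _ _ _ M); first by apply: (@swap_equiv i u x y (v1 ++ v2)).
apply: (IHv (rcons u y)); rewrite ?cat_rcons //.
by move=> j ji; rewrite MD // DE.
Qed.

Lemma strand_equiv i w u v D E : perm_eq w v ->
  D i = u ++ w -> E i = u ++ v -> (forall j, j != i -> E j = D j) -> equiv D E.
Proof.
elim: w u v E => [|x w IHw] u v E wv Di Ei DE.
  have v0 : v = [::] by apply/nilP; rewrite /nilp -(perm_size wv).
  apply: same_equiv => j; have [->|/DE //] := eqVneq j i.
  by rewrite Di Ei v0.
have xv : x \in v by rewrite -(perm_mem wv) inE eqxx.
case/splitPr: xv wv Ei => v1 v2 wv Ei.
have wv' : perm_eq w (v1 ++ v2).
  by rewrite -(perm_cons x) (perm_trans wv) // perm_catC /= perm_cons perm_catC.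
have [|M [Mi MD]] := @reorder_strand D i (u ++ x :: v1 ++ v2).
  by rewrite Di perm_cat2l perm_cons.
apply: (@rst_trans _ _ _ M).
  by apply: (IHw (rcons u x)) wv' _ _ _; rewrite ?cat_rcons.
by apply: move_equiv Mi Ei _ => j ji; rewrite MD // DE.
Qed.

(** The strands are reordered one after the other. *)
Lemma perm_equiv D E : (forall i, perm_eq (D i) (E i)) -> equiv D E.
Proof.
move=> DE; have : forall i, i \notin enum 'I_n -> E i = D i.
  by move=> i; rewrite mem_enum.
elim: (enum _) D DE => [|i s IHs] D DE sDE.
  by apply: same_equiv => i; rewrite sDE.
have [M [Mi MD]] := reorder_strand (DE i).
apply: (@rst_trans _ _ _ M); first by apply: (@strand_equiv i _ [::] _ _ _ (DE i)).
apply: IHs => j; first by have [->|/MD->] := eqVneq j i; rewrite ?Mi.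
by move=> js; have [->//|ji] := eqVneq j i; rewrite MD // sDE // inE negb_or ji.
Qed.

Lemma relabel_perm_equiv f D E : injective f ->
  (forall i, perm_eq (E i) (map (relabel f) (D i))) -> equiv D E.
Proof.
move=> fI ED; pose c : code n := [ffun i => map (relabel f) (D i)].
have Ec i : perm_eq (E i) (c i) by rewrite ffunE.
have cP := gauss_code_perm (endpoints_perm Ec) (gauss_valP E).
apply: (@rst_trans _ _ _ (Gauss cP)).
  by apply: rst_step; constructor 1; exists f => // i; rewrite /= ffunE.
by apply: perm_equiv => i; rewrite perm_sym.
Qed.

End Reordering.

(** * Diagrams with one arrow *)

Section Generators.
Variable n : nat.
Implicit Types (c d : code n) (D E : gauss n) (i j : 'I_n).

Local Notation equiv := (@equivalent VC n).

Definition two_ends i j (t h : word) : code n :=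
  [ffun k => (if k == i then t else [::]) ++ (if k == j then h else [::])].

Lemma endpoints_two_ends i j t h :
  perm_eq (endpoints (two_ends i j t h)) (t ++ h).
Proof.
have := @perm_flatten_cat _ _ (two_ends i j t h)
  (fun k => if k == i then t else [::])
  (fun k => if k == j then h else [::]) (enum 'I_n).
by rewrite !flatten_at ?enum_uniq ?mem_enum //; apply=> k; rewrite ffunE.
Qed.

Lemma gauss_two_ends i j t h :
  uniq [seq (arrow e, is_head e) | e <- t ++ h] ->
  all (fun e => flip e \in t ++ h) (t ++ h) -> gauss_code (two_ends i j t h).
Proof.
have th := endpoints_two_ends i j t h.
move=> uth fth; rewrite /gauss_code (perm_uniq (perm_map _ th)) uth /=.
by apply/allP => e; rewrite !(perm_mem th); exact: (allP fth).
Qed.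

Lemma applies_two_ends (r : rule) i j t h t' h' D E :
  r [:: t; h] [:: t'; h'] ->
  gauss_val D = two_ends i j t h -> gauss_val E = two_ends i j t' h' ->
  applies r D E.
Proof.
move=> rth Di Ei.
exists (fun k => (if k == i then [:: inr 0] else [::])
              ++ (if k == j then [:: inr 1] else [::])), [:: t; h], [:: t'; h'].
split=> //; last 2 first.
- rewrite Di; apply/ffunP => k; rewrite !ffunE.
  by do 2!case: ifP; rewrite /= ?cats0.
- rewrite Ei; apply/ffunP => k; rewrite !ffunE.
  by do 2!case: ifP; rewrite /= ?cats0.
have := @perm_flatten_cat _ _ (fun k => (if k == i then [:: 0] else [::])
  ++ (if k == j then [:: 1] else [::])) (fun k => if k == i then [:: 0] else [::])
  (fun k => if k == j then [:: 1] else [::]) (enum 'I_n) (fun k => perm_refl _).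
rewrite !flatten_at ?enum_uniq ?mem_enum //; congr (perm_eq (flatten _) _).
by apply: eq_map => k; do 2!case: ifP.
Qed.

Lemma single_gauss i j s : gauss_code (two_ends i j [:: tail 0 s] [:: head 0 s]).
Proof. by apply: gauss_two_ends => //=; rewrite !inE !eqxx !orbT. Qed.

Definition single_arrow i j s : gauss n := Gauss (single_gauss i j s).

Lemma single_self i s : equiv (empty_diagram n) (single_arrow i i s).
Proof.
apply: welded_equiv.
apply: (@applies_strand _ welded _ _ _ _ i [::] [::] [:: 0] (R1 0 s true)) => //=.
- by rewrite ffunE.
- by rewrite ffunE eqxx.
- by move=> j /negbTE ji; rewrite !ffunE ji.
Qed.

(** VC reverses the arrow; the reordering matters when i = j. *)
Lemma single_sym i j s : equiv (single_arrow i j s) (single_arrow j i s).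
Proof.
have H : gauss_code (two_ends i j [:: head 0 s] [:: tail 0 s]).
  by apply: gauss_two_ends => //=; rewrite !inE !eqxx !orbT.
apply: (@rst_trans _ _ _ (Gauss H)).
  by apply: VC_equiv; apply: applies_two_ends (VC_intro 0 s) _ _.
by apply: perm_equiv => k; rewrite !ffunE perm_catC.
Qed.

(** R2 creates both arrows with adjacent tails and adjacent heads, which is the
    stacking up to the order of the endpoints. *)
Lemma single_cancel i j s :
  equiv (empty_diagram n) (stack (single_arrow i j s) (single_arrow i j (~~ s))).
Proof.
have H : gauss_code (two_ends i j [:: tail 0 s; tail 1 (~~ s)]
                                  [:: head 0 s; head 1 (~~ s)]).
  by apply: gauss_two_ends => //=; rewrite !inE !eqxx !orbT.
apply: (@rst_trans _ _ _ (Gauss H)).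
  apply/welded_equiv/(applies_two_ends (R2 0 1 s true true)) => //.
  by apply/ffunP => k; rewrite !ffunE !if_same.
apply: perm_equiv => k; rewrite stackE /= !ffunE.
case: ifP => _; case: ifP => _ //=.
by rewrite perm_cons (perm_catCA [:: _] [:: _]).
Qed.

(** Exchanging even and odd names turns one stacking into the other, up to the
    order of the endpoints on each strand. *)
Lemma stackC D E : equiv (stack D E) (stack E D).
Proof.
apply: (@relabel_perm_equiv _ (fun m => if odd m then m.-1 else m.+1)).
  by move=> x y /=; do 2?case: ifP; lia.
move=> i; rewrite !stackE map_cat !map_relabel_comp perm_catC.
rewrite [map (relabel (_ \o double)) _](@eq_map_relabel _ (fun m => m.*2.+1)).
  rewrite [map (relabel (_ \o fun m => m.*2.+1)) _](@eq_map_relabel _ double) //.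
  by move=> m /=; rewrite odd_double.
by move=> m /=; rewrite odd_double.
Qed.

Lemma endpoints_erase a D :
  endpoints ([ffun i => [seq e <- D i | arrow e != a]] : code n)
  = [seq e <- endpoints D | arrow e != a].
Proof.
rewrite /endpoints filter_flatten; congr flatten; rewrite -[RHS]map_comp.
by apply: eq_map => i; rewrite ffunE.
Qed.

Lemma erase_gauss a D :
  gauss_code ([ffun i => [seq e <- D i | arrow e != a]] : code n).
Proof.
rewrite /gauss_code endpoints_erase.
case/andP: (gauss_valP D) => uD _; apply/andP; split.
  exact: subseq_uniq (map_subseq _ (filter_subseq _ _)) uD.
apply/allP => e; rewrite !mem_filter => /andP[-> eD].
exact: gauss_flip.
Qed.

Definition erase a D : gauss n := Gauss (erase_gauss a D).

Lemma size_erase a D e : e \in endpoints D -> arrow e = a ->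
  size (endpoints (erase a D)) < size (endpoints D).
Proof.
move=> eD ea.
rewrite endpoints_erase size_filter ltn_neqAle count_size andbT -all_count.
by apply/negP => /allP/(_ e eD); rewrite ea eqxx.
Qed.

(** Endpoints move freely, so those of the arrow [a] can be carried to the ends
    of their strands, which is where stacking puts them. The renaming gives it
    the name 1, the odd name of the arrow 0 of the second factor, and gives the
    other arrows the even names of the first factor. *)
Lemma extract_arrow D i j a s : tail a s \in D i -> head a s \in D j ->
  equiv D (stack (erase a D) (single_arrow i j s)).
Proof.
move=> ti hj; pose f m := if m == a then 1 else m.*2.
apply: (@relabel_perm_equiv _ f) => [x y|k].
  by rewrite /f; do 2!case: eqP; lia.
have ends : perm_eq (two_ends i j [:: tail a s] [:: head a s] k)
                    [seq e <- D k | predC (fun e => arrow e != a) e].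
  apply: uniq_perm.
  - by rewrite ffunE; do 2!case: ifP => _; rewrite /= ?inE ?endpoint_eqE ?andbF.
  - exact/filter_uniq/gauss_strand_uniq.
  move=> e; rewrite ffunE mem_filter mem_cat /= negbK.
  apply/orP/andP => [[] | [/eqP ea ek]].
  - by case: eqP => // ->; rewrite inE => /eqP->; split=> //=; exact: eqxx.
  - by case: eqP => // ->; rewrite inE => /eqP->; split=> //=; exact: eqxx.
  have [eE|eE] := same_arrow (mem_endpoints ti) (mem_endpoints ek) (esym ea);
    rewrite eE in ek *.
  - by left; rewrite (gauss_strand_inj ek ti) eqxx inE.
  - by right; rewrite (gauss_strand_inj ek hj) eqxx inE.
have Dk := permEl (perm_filterC (fun e => arrow e != a) (D k)).
apply: perm_trans (perm_map (relabel f) Dk); rewrite stackE map_cat.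
apply: perm_cat.
  rewrite [X in perm_eq X _]
    (_ : _ = map (relabel f) [seq e <- D k | arrow e != a]) //.
  rewrite /= ffunE; apply/eq_in_map => e.
  by rewrite mem_filter /relabel /f => /andP[/negbTE->].
apply: perm_trans (perm_map (relabel f) ends).
by rewrite /= !ffunE; do 2!case: ifP => _; rewrite /= /relabel /f /= ?eqxx.
Qed.

Lemma lk_single u v i j s : u != v ->
  lk u v (single_arrow i j s) =
  (if (u == i) && (v == j) || (u == j) && (v == i) then sgn s else 0)%R.
Proof.
move=> uv; rewrite /lk /= !ffunE.
have [ui|_] := eqVneq u i; have [uj|_] := eqVneq u j;
have [vi|_] := eqVneq v i; have [vj|_] := eqVneq v j;
  rewrite /= ?big_cons ?big_nil ?inE /flip /= ?eqxx ?endpoint_eqE ?andbF ?addr0 //=.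
all: by move: uv; rewrite ?ui ?uj ?vi ?vj -?ui -?uj -?vi -?vj ?eqxx.
Qed.

End Generators.

(** * The abelian group of string links modulo VC *)

Section Group.
Variable n : nat.
Local Notation Q := (wSL VC n).
Local Notation pi := (\pi_(wSL VC n)).

(** One-arrow diagrams generate: induction on the number of endpoints, taking
    out the arrow of any endpoint. *)
Lemma wSL_arrow_ind (P : Q -> Prop) :
  P (wSL_one VC n) ->
  (forall x i j s, P x -> P (wSL_mul x (pi (single_arrow i j s)))) ->
  forall x, P x.
Proof.
move=> P1 Pmul; elim/quotW => D; have [m] := ubnP (size (endpoints D)).
elim: m D => // m IHm D; case ED: (endpoints D) => [|e w] lt_m.
  suff -> : D = empty_diagram n by [].
  apply: gauss_eq => i; rewrite ffunE; apply/nilP; rewrite /nilp -leqn0.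
  rewrite leqNgt; apply/negP; case Di: (D i) => [|e w] // _.
  by have := @mem_endpoints _ D e i; rewrite ED Di inE eqxx => /(_ isT).
have eD : e \in endpoints D by rewrite ED inE eqxx.
have [i [j [ti hj]]] : exists i j,
    tail (arrow e) (positive e) \in D i /\ head (arrow e) (positive e) \in D j.
  have /mem_endpointsP[k ek] := eD.
  have /mem_endpointsP[l fl] := gauss_flip eD.
  by case: e {ED eD lt_m} ek fl => a [] s /= ek fl; [exists l, k | exists k, l].
have /wSLP-> := extract_arrow ti hj; rewrite (pi_stack VC); apply/Pmul/IHm.
by apply: leq_trans (size_erase eD (erefl _)) _; rewrite -ltnS ED.
Qed.

Lemma wSL_mulC : commutative (@wSL_mul VC n).
Proof.
elim/quotW => D; elim/quotW => E; rewrite -(pi_stack VC D E) -(pi_stack VC E D).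
exact/wSLP/stackC.
Qed.

Lemma pi_single_cancel i j s :
  wSL_mul (pi (single_arrow i j s)) (pi (single_arrow i j (~~ s))) = wSL_one VC n.
Proof. by rewrite -(pi_stack VC); apply/esym/wSLP/single_cancel. Qed.

(** A product of generators is inverted by changing all the signs. *)
Lemma wSL_inverse (x : Q) : exists y, wSL_mul y x = wSL_one VC n.
Proof.
elim/wSL_arrow_ind: x => [|x i j s [y yx]].
  by exists (wSL_one VC n); rewrite wSL_mul1g.
exists (wSL_mul (pi (single_arrow i j (~~ s))) y).
rewrite wSL_mulA -(wSL_mulA _ y) yx wSL_mulg1 wSL_mulC.
exact: pi_single_cancel.
Qed.

Definition wSL_opp (x : Q) : Q := projT1 (cid (wSL_inverse x)).

Lemma wSL_addN : left_inverse (wSL_one VC n) wSL_opp (@wSL_mul VC n).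
Proof. by move=> x; rewrite /wSL_opp; case: cid. Qed.

HB.instance Definition _ := GRing.isZmodule.Build Q
  (@wSL_mulA VC n) wSL_mulC (@wSL_mul1g VC n) wSL_addN.

End Group.

(** * The classification *)

Section Classification.
Variable n : nat.
Local Notation Q := (wSL VC n).
Local Notation pi := (\pi_(wSL VC n)).

Definition wvlk (x : Q) : {ffun upair n -> int} := vlk_sym (repr x).

Lemma wvlk_pi D : wvlk (pi D) = vlk_sym D.
Proof. by apply/equivalent_vlk/wSLP; rewrite reprK. Qed.

Lemma wvlkD (x y : Q) : wvlk (x + y)%R = (wvlk x + wvlk y)%R.
Proof.
by rewrite -[x]reprK -[y]reprK -[(_ + _)%R](pi_stack VC) !wvlk_pi vlk_stack.
Qed.

Lemma wvlk_is_additive : zmod_morphism wvlk.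
Proof.
by move=> x y; apply/eqP; rewrite eq_sym subr_eq -wvlkD subrK.
Qed.
HB.instance Definition _ := GRing.isZmodMorphism.Build _ _ wvlk wvlk_is_additive.

Definition generator (p : upair n) : Q :=
  pi (single_arrow (val p).1 (val p).2 true).

Definition realize (v : {ffun upair n -> int}) : Q :=
  (\sum_p generator p *~ v p)%R.

Lemma realizeD v w : realize (v + w)%R = (realize v + realize w)%R.
Proof.
by rewrite /realize -big_split; apply: eq_bigr => p _; rewrite ffunE mulrzDr.
Qed.

Lemma wvlk_generator p q : wvlk (generator p) q = (q == p)%:R%R.
Proof.
rewrite wvlk_pi vlk_symE lk_single ?upair_neq //.
have -> : (q == p) = ((val q).1 == (val p).1) && ((val q).2 == (val p).2).
  by rewrite -val_eqE; case: (val q) (val p) => ? ? [].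
case: p q => -[i j] /= ij [[u v] /= uv].
case: andP => //= _; case: andP => //= -[/eqP uj /eqP vi].
by move: ij; rewrite -uj -vi ltnNge (ltnW uv).
Qed.

Lemma realizeK : cancel realize wvlk.
Proof.
move=> v; rewrite /realize raddf_sum; apply/ffunP => q; rewrite sum_ffunE.
rewrite (bigD1 q) //= big1 ?addr0 => [|p pq];
  rewrite raddfMz ffunMzE wvlk_generator.
  by rewrite eqxx; exact: intz.
by rewrite eq_sym (negbTE pq) mul0rz.
Qed.

Lemma pi_single_opp i j s :
  pi (single_arrow i j (~~ s)) = (- pi (single_arrow i j s))%R.
Proof.
by apply/eqP; rewrite -addr_eq0 addrC; apply/eqP/pi_single_cancel.
Qed.

(** For i < j and a positive sign this says that [wvlk] maps a generator to a
    basis vector; the other cases reduce to it by R2, VC and R1. *)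
Lemma realize_single i j s :
  realize (vlk_sym (single_arrow i j s)) = pi (single_arrow i j s).
Proof.
have up (p : upair n) t : realize (vlk_sym (single_arrow (val p).1 (val p).2 t)) =
    pi (single_arrow (val p).1 (val p).2 t).
  have pos : realize (wvlk (generator p)) = generator p.
    rewrite /realize (bigD1 p) //= big1 ?addr0 => [|q qp]; rewrite wvlk_generator.
      by rewrite eqxx mulr1z.
    by rewrite (negbTE qp) mulr0z.
  rewrite -wvlk_pi; case: t; first exact: pos.
  rewrite (pi_single_opp _ _ true) -/(generator p) raddfN.
  rewrite -[in RHS]pos /realize -sumrN.
  by apply: eq_bigr => q _; rewrite ffunE mulrNz.
case: (ltngtP i j) => [ij|ji|/val_inj->].
- exact: (up (exist _ (i, j) ij)).
- rewrite (equivalent_vlk (single_sym i j s)) ((wSLP _ _ _).2 (single_sym i j s)).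
  exact: (up (exist _ (j, i) ji)).
- rewrite -(equivalent_vlk (single_self j s)) -((wSLP _ _ _).2 (single_self j s)).
  rewrite -wvlk_pi (_ : pi (empty_diagram n) = 0%R) // raddf0.
  rewrite /realize big1 // => p _.
  by rewrite ffunE mulr0z.
Qed.

(** The composite [realize \o wvlk] and the identity are additive, so it
    suffices to compare them on one-arrow diagrams. *)
Lemma wvlkK : cancel wvlk realize.
Proof.
elim/wSL_arrow_ind => [|x i j s xK].
  rewrite (_ : wvlk _ = 0%R); last exact: (raddf0 wvlk).
  by rewrite /realize big1 // => p _; rewrite ffunE mulr0z.
by rewrite wvlkD realizeD xK wvlk_pi realize_single.
Qed.

End Classification.

Theorem proposition3p7 (n : nat) (hn : 1 <= n) :
  [/\ forall D D' : gauss n, same_diagram D D' -> vlk_sym D = vlk_sym D',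
      forall D D' : gauss n, applies welded D D' -> vlk_sym D = vlk_sym D',
      forall D D' : gauss n, applies VC D D' -> vlk_sym D = vlk_sym D' &
      exists phi : wSL VC n -> {ffun upair n -> int},
        [/\ forall D : gauss n, phi (\pi_(wSL VC n) D) = vlk_sym D,
            phi 1%g = 0%R,
            forall x y : wSL VC n, phi (x * y)%g = (phi x + phi y)%R
          & bijective phi]].
Proof.
split=> [D D'|D D' H|D D' H|]; first exact: same_diagram_vlk.
- by apply: equivalent_vlk; exact: welded_equiv.
- by apply: equivalent_vlk; exact: VC_equiv.
exists (@wvlk n); split.
- exact: wvlk_pi.
- exact: (raddf0 (@wvlk n)).
- exact: wvlkD.
- by exists (@realize n); [exact: wvlkK | exact: realizeK].
Qed.
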